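(* Let $f\ge 1$. Any randomized fault-tolerant routing scheme resilient to $f$ edge faults incurs an expected stretch of $\Omega(f)$ on some instance, regardless of the size of the routing tables and labels; in particular this holds even if every routing table contains complete information about the graph.
   Context: A fault-tolerant routing scheme resilient to $f$ faults assigns each vertex a label and a routing table in advance; then, for a source $s$, destination $t$ and an unknown set $F$ of at most $f$ failed edges, the message is forwarded hop by hop, where each vertex decides the next port based on its table, the header and labels, and a failed edge is revealed only when the message reaches one of its endpoints. The stretch is the ratio between the length of the route traversed until the message reaches $t$ and $\mathrm{dist}_{G\setminus F}(s,t)$. *)

(* Defs.v *)
From HB Require Import structures.
From mathcomp Require Import all_boot all_order all_algebra.
From mathcomp Require Import all_classical all_reals all_analysis.
From mathcomp Require Import measurable_realfun.

Set Implicit Arguments.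
Unset Strict Implicit.
Unset Printing Implicit Defensive.

Import Order.TTheory GRing.Theory Num.Theory.

Local Open Scope classical_set_scope.
Local Open Scope ring_scope.

(* A finite simple graph with a port numbering: port i of v leads to the i-th
   entry of [ports v], and [ports v] lists the neighbours of v. *)
Record graph := Graph {
  vertex :> finType;
  ports : vertex -> seq vertex;
  ports_uniq : forall v, uniq (ports v);
  ports_irrefl : forall v, v \notin ports v;
  ports_sym : forall u v, (u \in ports v) = (v \in ports u) }.

Definition adj (G : graph) : rel G := fun u v => v \in ports u.

Definition edges (G : graph) : {set {set G}} :=
  [set [set x.1; x.2]%SET | x : G * G & adj x.1 x.2]%SET.

(* The adjacency relation of G \ F. *)
Definition surviving (G : graph) (F : {set {set G}}) : rel G :=
  fun u v => adj u v && ([set u; v]%SET \notin F).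

(* Number of edges of a shortest path from s to t. Such a path has fewer than
   #|T| edges, so the value is #|T| exactly when t is unreachable from s. *)
Definition dist (T : finType) (e : rel T) (s t : T) : nat :=
  find (fun k => [exists p : k.-tuple T, path e s p && (last s p == t)])
       (iota 0 #|T|).

Definition failed_ports (G : graph) (F : {set {set G}}) (v : G) : seq nat :=
  [seq i <- iota 0 (size (ports v)) | [set v; nth v (ports v) i]%SET \in F].

(* [forward tab lv lt h fp] is the decision taken at a vertex with table [tab]
   and label [lv], for a message with destination label [lt] and header [h],
   when [fp] are the failed ports of that vertex: the port on which to send the
   message, and the new header. Apart from the header, [fp] is the only
   information about the faults. Labels, tables and headers live in arbitrary
   types, so their size is unrestricted. *)
Record routing_scheme (Label Table Header : Type) := RoutingScheme {
  label : forall G : graph, G -> Label;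
  table : forall G : graph, G -> Table;
  header0 : Header;
  forward : Table -> Label -> Label -> Header -> seq nat -> nat * Header }.

Section Routing.
Variables (Label Table Header : Type).
Variables (A : routing_scheme Label Table Header).
Variables (G : graph) (F : {set {set G}}) (s t : G).

(* The message is lost ([None]) if it is sent on a failed or nonexistent port. *)
Definition hop (vh : G * Header) : option (G * Header) :=
  let: (v, h) := vh in
  let fp := failed_ports F v in
  let: (i, h') := forward A (table A v) (label A v) (label A t) h fp in
  if (i < size (ports v))%N && (i \notin fp)
  then Some (nth v (ports v) i, h') else None.

Definition route (k : nat) : option (G * Header) :=
  iter k (obind hop) (Some (s, header0 A)).

Definition reaches_at (k : nat) : Prop := omap fst (route k) = Some t.

Definition delivered : Prop := exists k, reaches_at k.

(* Number of edges traversed until the message first reaches t; +oo if it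
   never does. *)
Definition route_length (R : realType) : \bar R :=
  ereal_inf [set k%:R%:E | k in [set k | reaches_at k]].

Definition stretch (R : realType) : \bar R :=
  (route_length R * ((dist (surviving F) s t)%:R^-1)%:E)%E.

End Routing.

(* A randomized scheme is a random variable A with values in the deterministic
   schemes: labels, tables and forwarding decisions may all depend on the random
   seed w. The instance (G, F, s, t) is fixed independently of w. *)
Section Randomized.
Variables (R : realType) (d : measure_display) (Omega : measurableType d).
Variables (P : probability Omega R).
Variables (Label Table Header : Type).
Variables (A : Omega -> routing_scheme Label Table Header).

Definition measurable_routing : Prop :=
  forall (G : graph) (F : {set {set G}}) (s t : G),
    measurable_fun [set: Omega]
      (fun w => route_length (A w) F s t R).

Definition resilient (f : nat) : Prop :=
  forall (G : graph) (F : {set {set G}}) (s t : G),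
    F \subset edges G -> (#|F| <= f)%N -> connect (surviving F) s t ->
    {ae P, forall w, delivered (A w) F s t}.

Definition expected_stretch (G : graph) (F : {set {set G}}) (s t : G) : \bar R :=
  (\int[P]_w stretch (A w) F s t R)%E.

End Randomized.

(* Main.v *)
Require Import Defs.
From HB Require Import structures.
From mathcomp Require Import all_boot all_order all_algebra.
From mathcomp Require Import all_classical all_reals all_analysis.
From mathcomp Require Import measurable_realfun.
From mathcomp Require Import zify lra.

Set Implicit Arguments.
Unset Strict Implicit.
Unset Printing Implicit Defensive.

Import Order.TTheory GRing.Theory Num.Theory.

Local Open Scope classical_set_scope.
Local Open Scope ring_scope.

(** The hard instances live on the graph with [f + 1] internally disjoint paths
    [source - mid i - target], in which every edge [mid j - target] fails except
    the one at a single hidden index [i].  A fault is only seen at its endpoint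
    [mid j], so until its first visit to [mid i] the message moves as it would
    if all of the edges [mid j - target] had failed; that run does not depend
    on [i] and visits at most [N] vertices in [N] steps.  With [N] about
    [f / 2], a route of length at least [N] is forced for half of the indices
    [i], whereas the distance is 2.  Averaging the expected stretch over [i]
    yields an index with expected stretch at least [f / 8]. *)

(** * Elementary bounds on distances *)

Section Dist.
Variables (T : finType) (e : rel T) (s t : T).

Lemma dist_gt0 : s != t -> (0 < dist e s t)%N.
Proof.
move=> st; rewrite lt0n; apply/eqP => d0.
(* [dist] defaults to [#|T|] when nothing is found; as [T] is inhabited, the value 0 can only come
   from an empty path. *)
have cT : (0 < #|T|)%N by apply/card_gt0P; exists s.
have : has (fun k => [exists p : k.-tuple T, path e s p && (last s p == t)])
  (iota 0 #|T|) by rewrite has_find -/(dist e s t) d0 size_iota.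
move/(nth_find 0%N); rewrite -/(dist e s t) d0 nth_iota // add0n.
case/existsP => p; rewrite (tuple0 p) /= => /eqP st'.
by rewrite st' eqxx in st.
Qed.

Lemma dist_le (p : seq T) :
  path e s p -> last s p = t -> (size p < #|T|)%N -> (dist e s t <= size p)%N.
Proof.
move=> ep pt sp; rewrite leqNgt; apply/negP => /(before_find 0%N).
rewrite nth_iota // add0n => /existsP; apply.
by exists (in_tuple p); rewrite ep /= pt eqxx.
Qed.

End Dist.

(** * The hard graph and its fault sets *)

Section LensGraph.
Variable n : nat.

(** The complete bipartite graph $K_{2,n}$, with the two booleans as hubs. *)
Definition lens_ports (v : 'I_n + bool) : seq ('I_n + bool) :=
  if v is inl _ then [:: inr false; inr true] else [seq inl i | i <- enum 'I_n].

Lemma lens_ports_uniq v : uniq (lens_ports v).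
Proof. by case: v => [i|b] //=; rewrite map_inj_uniq ?enum_uniq // => i j []. Qed.

Lemma mem_lens_ports u v :
  (u \in lens_ports v) =
  match u, v with inl _, inr _ | inr _, inl _ => true | _, _ => false end.
Proof.
case: v => [j|b] /=; first by case: u => [i|[]].
case: u => [i|c] /=; first by rewrite mem_map ?mem_enum // => i' j [].
by apply/negP => /mapP[].
Qed.

Lemma lens_ports_irrefl v : v \notin lens_ports v.
Proof. by rewrite mem_lens_ports; case: v. Qed.

Lemma lens_ports_sym u v : (u \in lens_ports v) = (v \in lens_ports u).
Proof. by rewrite !mem_lens_ports; case: u; case: v. Qed.

Definition lens : graph :=
  Graph lens_ports_uniq lens_ports_irrefl lens_ports_sym.

Definition source : lens := inr false.
Definition target : lens := inr true.
Definition mid (i : 'I_n) : lens := inl i.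

Definition target_faults (B : {set 'I_n}) : {set {set lens}} :=
  [set [set mid j; target]%SET | j in B]%SET.

Lemma mem_target_faults (B : {set 'I_n}) (j : 'I_n) (b : bool) :
  ([set mid j; inr b : lens]%SET \in target_faults B) = b && (j \in B).
Proof.
apply/imsetP/andP => [[k kB /setP E]|[-> jB]]; last by exists j.
(* The two edges are compared at [mid j], which gives [j = k], and then at [target], which gives
   [b = true]. *)
have := E (mid j); rewrite !inE eqxx /= orbF => /esym/eqP[jk].
have := E target; rewrite !inE eqxx /= => /eqP[<-].
by rewrite jk.
Qed.

Lemma target_faults_edges B : target_faults B \subset edges lens.
Proof.
apply/fintype.subsetP => _ /imsetP[j _ ->]; apply/imsetP; exists (mid j, target) => //.
by rewrite inE [adj _ _]mem_lens_ports.
Qed.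

Lemma surviving_path (B : {set 'I_n}) i :
  i \notin B -> path (surviving (target_faults B)) source [:: mid i; target].
Proof.
move=> iB; rewrite /= andbT /surviving ![adj _ _]mem_lens_ports /=.
by rewrite finset.setUC !mem_target_faults.
Qed.

Lemma dist_source_target (B : {set 'I_n}) i :
  i \notin B -> (0 < dist (surviving (target_faults B)) source target <= 2)%N.
Proof.
move=> iB; rewrite dist_gt0 //=; apply: (dist_le (surviving_path iB)) => //=.
(* The search in [dist] stops below [n + 2] vertices; length 2 is covered since [i] witnesses
   [0 < n]. *)
by rewrite card_sum card_ord card_bool addn2 !ltnS (leq_ltn_trans _ (ltn_ord i)).
Qed.

Lemma failed_ports_source B : failed_ports (target_faults B) source = [::].
Proof.
rewrite /failed_ports -[RHS](filter_pred0 (iota 0 (size (ports source)))).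
apply: eq_in_filter => k; rewrite mem_iota add0n /= => kn.
have /mapP[j _ ->] := mem_nth source kn.
by rewrite finset.setUC mem_target_faults.
Qed.

Lemma failed_ports_mid (B : {set 'I_n}) j :
  failed_ports (target_faults B) (mid j) = if j \in B then [:: 1%N] else [::].
Proof. by rewrite /failed_ports /= !mem_target_faults /=; case: (j \in B). Qed.

(** * Runs of a deterministic scheme *)

Section Runs.
Variables (Label Table Header : Type).
Variable A : routing_scheme Label Table Header.

Notation run B := (route A (target_faults B) source target).

(** Faults enter a hop only through the failed ports of the current vertex. The source sees none,
    and [mid j] sees only whether [j] is faulty; [target], which sees all faults, is excluded. *)
Lemma hop_target_faults (B C : {set 'I_n}) (vh : lens * Header) :
  vh.1 != target -> (forall j, vh.1 = mid j -> (j \in B) = (j \in C)) ->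
  hop A (target_faults B) target vh = hop A (target_faults C) target vh.
Proof.
case: vh => v h /= vt BC.
suff E : failed_ports (target_faults B) v = failed_ports (target_faults C) v.
  by rewrite /hop E.
case: v vt BC => [j|[]] // _ BC; last by rewrite !failed_ports_source.
by rewrite !failed_ports_mid (BC j).
Qed.

(** A last hop into [target] would leave some [mid j] through port 1, which has failed; hubs lead
    only to middle vertices. *)
Lemma run_full_not_target k : omap fst (run [set: 'I_n]%SET k) != Some target.
Proof.
case: k => [//|k]; rewrite /route iterS -/(route _ _ _ _ k).
case: (route _ _ _ _ k) => [[v h]|] //=.
case: (forward _ _ _ _ _ _) => i h'; case: ifP => // /andP[iv ifp] /=.
apply/eqP => -[E]; case: v iv ifp E => [j|b] /= iv.
  by rewrite failed_ports_mid finset.in_setT; case: i iv => [|[]].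
have /mapP[j _ ->] := mem_nth (inr b : lens) iv.
by [].
Qed.

(* Before its first visit to [mid i], the message sees the same faults whether
   or not the edge from [mid i] to [target] has failed. *)
Lemma run_agree i k :
  (forall j, (j < k)%N -> omap fst (run [set: 'I_n]%SET j) != Some (mid i)) ->
  run [set~ i]%SET k = run [set: 'I_n]%SET k.
Proof.
elim: k => [//|k IH] avoid; rewrite /route !iterS -!/(route _ _ _ _ k) IH; last first.
  by move=> j jk; apply: avoid; rewrite ltnS ltnW.
have := avoid k (ltnSn k); have := run_full_not_target k.
case: (run [set: 'I_n]%SET k) => [[v h]|] //= vt vi.
apply: (@hop_target_faults _ _ (v, h)) => /= [|j vj].
  by apply: contraNneq vt => ->.
rewrite !inE; apply: contraNneq vi => <-.
by rewrite vj.
Qed.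

Definition visited (N : nat) : {set 'I_n} :=
  [set i | Some (mid i) \in [seq omap fst (run [set: 'I_n]%SET j) | j <- iota 0 N]]%SET.

Lemma card_visited N : (#|visited N| <= N)%N.
Proof.
have inj : injective (fun i => Some (mid i)) by move=> i j [].
rewrite -(card_imset _ inj) -[leqRHS](size_iota 0).
rewrite -(size_map (fun j => omap fst (run [set: 'I_n]%SET j))).
apply: leq_trans (card_size _); apply: subset_leq_card.
by apply/fintype.subsetP => _ /imsetP[i + ->]; rewrite inE.
Qed.

(** An arrival before time [N] would belong to the run with all target edges failed, which
    [run_agree] identifies with this one up to then. *)
Lemma reaches_at_ge i N k :
  i \notin visited N -> reaches_at A (target_faults [set~ i]%SET) source target k ->
  (N <= k)%N.
Proof.
rewrite inE => iN; rewrite /reaches_at leqNgt => rk; apply/negP => kN.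
move: rk; rewrite run_agree => [|j jk]; first by apply/eqP/run_full_not_target.
apply: contraNneq iN => <-; apply: map_f.
by rewrite mem_iota /= add0n (ltn_trans jk).
Qed.

(** The indicator makes the bound valid for every [i], so that it can be summed over the indices. *)
Lemma stretch_ge (R : realType) i N :
  ((N%:R / 2 * (i \notin visited N)%:R)%:E <=
   stretch A (target_faults [set~ i]%SET) source target R)%E.
Proof.
set b := i \notin _; rewrite /stretch.
have /andP[d0 d2] : (0 < dist (surviving (target_faults [set~ i]%SET)) source target <= 2)%N.
  by apply: (@dist_source_target _ i); rewrite !inE eqxx.
set D := dist _ _ _ in d0 d2 *.
have -> : (N%:R / 2 * b%:R = (b * N)%:R / 2 :> R).
  by rewrite natrM mulrC mulrA.
rewrite EFinM; apply: lee_pmul; rewrite ?lee_fin ?ler0n ?invr_ge0 //.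
  (* Only actual arrival times need a bound: without any, the infimum is infinite. *)
  apply: le_ereal_inf_tmp => _ [k rk <-]; rewrite lee_fin ler_nat.
  case: (boolP b) => [bi|]; last by rewrite mul0n.
  by rewrite mul1n; apply: reaches_at_ge rk.
by rewrite lef_pV2 ?posrE ?ltr0n // (ler_nat _ D 2).
Qed.

End Runs.
End LensGraph.

(** * Averaging over the hidden index *)

Lemma exists_ge_average (R : realType) (n : nat) (c : R) (F : 'I_n.+1 -> \bar R) :
  (((n.+1)%:R * c)%:E <= \sum_(i < n.+1) F i)%E -> exists i, (c%:E <= F i)%E.
Proof.
case: (arg_maxP F (erefl : xpredT (ord0 : 'I_n.+1))) => i _ maxi le_sum.
exists i; rewrite -(@lee_pmul2l _ (n.+1)%:R%:E) ?lte_fin ?ltr0n // -EFinM.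
apply: le_trans le_sum _; apply: le_trans (lee_sum _ (fun j _ => maxi j erefl)) _.
by rewrite sumr_const card_ord mule_natl.
Qed.

Lemma sum_stretch_ge (R : realType) (Label Table Header : Type)
    (A : routing_scheme Label Table Header) (f : nat) :
  (((f.+1)%:R * (8^-1 * f%:R))%:E <= \sum_(i < f.+1)
     stretch A (target_faults [set~ i]%SET) (source f.+1) (target f.+1) R)%E.
Proof.
set N := f.+1./2.
apply: le_trans (lee_sum _ (fun i _ => stretch_ge A R i N)).
rewrite sumEFin lee_fin -mulr_sumr -natr_sum.
have -> : (\sum_(i < f.+1) (i \notin visited f.+1 A N) = f.+1 - #|visited f.+1 A N|)%N.
  rewrite -[X in (X - _)%N](card_ord f.+1) -(cardsC (visited f.+1 A N)) addKn.
  rewrite -sum1_card [RHS]big_mkcond; apply: eq_bigr => i _.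
  by rewrite finset.in_setC; case: (_ \in _).
(* At least [f + 1 - N] indices are unvisited, and [f + 1] is [2N] or [2N + 1]. The factor 4 here
   and the distance 2 make up the constant 8. *)
have : (f.+1 * f <= 4 * (N * (f.+1 - #|visited f.+1 A N|)))%N.
  have := card_visited f.+1 A N; have := odd_double_half f.+1; rewrite -/N -mul2n.
  by case: (odd _) => /=; nia.
rewrite -(ler_nat R) !natrM => H.
rewrite -(@ler_pM2l _ 8) //; move: H; lra.
Qed.

Theorem theorem1p4 (R : realType) :
  exists2 c : R, 0 < c &
    forall (f : nat) (d : measure_display) (Omega : measurableType d)
      (P : probability Omega R) (Label Table Header : Type)
      (A : Omega -> routing_scheme Label Table Header),
      (1 <= f)%N ->
      measurable_routing R A ->
      resilient P A f ->
      exists (G : graph) (F : {set {set G}}) (s t : G),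
        [/\ F \subset edges G, (#|F| <= f)%N, s != t,
            connect (surviving F) s t &
            ((c * f%:R)%:E <= expected_stretch P A F s t)%E].
Proof.
exists 8^-1; first by rewrite invr_gt0.
move=> f d Omega P Label Table Header A _ mA _.
(* With [f + 1] paths, sparing one leaves a fault set within the budget [f]. *)
pose F (i : 'I_f.+1) := target_faults [set~ i]%SET.
pose X i w := stretch (A w) (F i) (source f.+1) (target f.+1) R.
have X0 i w : (0 <= X i w)%E.
  (* For [N = 0] the lower bound is 0. *)
  by apply: le_trans (stretch_ge (A w) R i 0); rewrite mul0r mul0r.
have mX i : measurable_fun setT (X i).
  rewrite (_ : X i = fun w => ((dist (surviving (F i)) (source f.+1)
    (target f.+1))%:R^-1%:E * route_length (A w) (F i) (source f.+1)
    (target f.+1) R)%E).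
    exact/measurable_funeM/mA.
  by apply/funext => w; rewrite /X /stretch muleC.
have [i ge_i] : exists i, ((8^-1 * f%:R)%:E <=
    expected_stretch P A (F i) (source f.+1) (target f.+1))%E.
  (* Nonnegativity lets the sum enter the integral, so the deterministic bound applies seed by seed
     and integrates against total mass 1. *)
  apply: exists_ge_average; rewrite -ge0_integral_sum // => [|j w _]; last exact: X0.
  rewrite -[leLHS]mule1 -(probability_setT P) -integral_cst //.
  apply: ge0_le_integral => //= [|w _].
  - exact: emeasurable_sum.
  - exact: sum_stretch_ge.
have iF : i \notin [set~ i]%SET by rewrite !inE eqxx.
exists (lens f.+1), (F i), (source f.+1), (target f.+1); split=> //.
- exact: target_faults_edges.
- by rewrite (leq_trans (leq_imset_card _ _)) // cardsC1 card_ord.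
- by apply/connectP; exists [:: mid i; target f.+1] => //; apply: surviving_path.
Qed.
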